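(* Fix $\alpha\ge0$ and let $A_n\in\mathcal B_{\Theta_n}$, $n\ge1$, be any sequence of sets. (1) Suppose $G^n$ and $M_n^{(\alpha)}$ merge in probability. Then there is some $r>0$ with $$\lim_{n\to\infty}P\big(\pi_n^{(\alpha)}(A_n^c|\underline X_n)<e^{-nr}\big)=1$$ if and only if there exist constants $r_1,r_2>0$ and sets $B_n,C_n\in\mathcal B_{\Theta_n}$ such that: (A1) $A_n\cup B_n\cup C_n=\Theta_n$ for each $n\ge1$; (A2) $\widetilde\pi_n^{(\alpha)}(B_n)=M_n^{(\alpha)}(\chi_n,B_n)/M_n^{(\alpha)}(\chi_n,\Theta_n)\le e^{-nr_1}$ for each $n\ge1$; (A3) there exist $S_n\in\mathcal B_n$ with $\lim_{n\to\infty}G^n(S_n)=0$ and $\sup_{\theta\in C_n}\dfrac{Q_n^{(\alpha)}(S_n^c|\theta)}{Q_n^{(\alpha)}(\chi_n|\theta)}\le e^{-nr_2}$. (2) Suppose $G^n$ and $M_n^{(\alpha)}$ merge with probability one. Then there is some $r>0$ with $$P\big(\pi_n^{(\alpha)}(A_n^c|\underline X_n)\ge e^{-nr}\ \text{infinitely often}\big)=0$$ if and only if there exist constants $r_1,r_2>0$ and sets $B_n,C_n\in\mathcal B_{\Theta_n}$ such that (A1) and (A2) above hold, together with (A3)$^*$ there exist $S_n\in\mathcal B_n$ with $P(\underline X_n\in S_n\ \text{infinitely often})=0$ and $\sup_{\theta\in C_n}\dfrac{Q_n^{(\alpha)}(S_n^c|\theta)}{Q_n^{(\alpha)}(\chi_n|\theta)}\le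 e^{-nr_2}$.
   Context: General set-up. For each sample size $n\ge1$, $\underline X_n$ is a random element, defined on an underlying true probability space $(\Omega,\mathcal B_\Omega,P)$, with values in a measurable space $(\chi_n,\mathcal B_n)$. Its law $G^n$ has density $g^n$ with respect to a $\sigma$-finite measure $\lambda^n$ on $\chi_n$ (integrals $d\underline x_n$ are with respect to $\lambda^n$). The model is a family $\{F^n(\cdot|\theta):\theta\in\Theta_n\}$, $\Theta_n\subseteq\mathbb R^p$, with densities $f^n(\cdot|\theta)$ with respect to $\lambda^n$. $\Theta_n$ carries a $\sigma$-field $\mathcal B_{\Theta_n}$ and a prior measure $\pi_n$ with $\pi_n(\Theta_n)\le1$. The $\alpha$-likelihood $q_n^{(\alpha)}(\underline x_n|\theta)$, $\alpha\ge0$, is a $\mathcal B_n\times\mathcal B_{\Theta_n}$-measurable function such that $q_n^{(0)}(\underline x_n|\theta)=\lim_{\alpha\downarrow0}q_n^{(\alpha)}(\underline x_n|\theta)=\log f^n(\underline x_n|\theta)-n$. For $S_n\in\mathcal B_n$, $A_n\in\mathcal B_{\Theta_n}$ put $Q_n^{(\alpha)}(S_n|\theta)=\int_{S_n}\exp(q_n^{(\alpha)}(\underline x_n|\theta))\,d\underline x_n$, $M_n^{(\alpha)}(S_n,A_n)=\int_{A_n}Q_n^{(\alpha)}(S_n|\theta)\,\pi_n(d\theta)$, $m_n^{(\alpha)}(\underline x_n,A_n)=\int_{A_n}\exp(q_n^{(\alpha)}(\underline x_n|\theta))\,\pi_n(d\theta)$. It is assumed throughout that $0<M_n^{(\alpha)}(\chi_n,\Theta_n)<\infty$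 and that $0<Q_n^{(\alpha)}(\chi_n|\theta)<\infty$. The $R^{(\alpha)}$-marginal distribution is $M_n^{(\alpha)}(S_n)=M_n^{(\alpha)}(S_n,\Theta_n)/M_n^{(\alpha)}(\chi_n,\Theta_n)$, with density $m_n^{(\alpha)}(\underline x_n)=m_n^{(\alpha)}(\underline x_n,\Theta_n)/M_n^{(\alpha)}(\chi_n,\Theta_n)$ with respect to $\lambda^n$. The $R^{(\alpha)}$-posterior is $\pi_n^{(\alpha)}(A_n|\underline x_n)=m_n^{(\alpha)}(\underline x_n,A_n)/m_n^{(\alpha)}(\underline x_n,\Theta_n)$ when the denominator is finite and positive (arbitrary otherwise, e.g. $\pi_n(A_n)$). The $\alpha$-modified prior is $\widetilde\pi_n^{(\alpha)}(d\theta)=Q_n^{(\alpha)}(\chi_n|\theta)\pi_n(d\theta)/M_n^{(\alpha)}(\chi_n,\Theta_n)$. Merging: $G^n$ and $M_n^{(\alpha)}$ merge in probability if for all $\epsilon>0$, $\lim_{n\to\infty}P\big(m_n^{(\alpha)}(\underline X_n)/g^n(\underline X_n)>e^{-n\epsilon}\big)=1$; they merge with probability one if for every $\epsilon>0$, $P\big(m_n^{(\alpha)}(\underline X_n)/g^n(\underline X_n)>e^{-n\epsilon}\text{ for all large }n\big)=1$. *)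

(* Defs.v *)
From HB Require Import structures.
From mathcomp Require Import all_boot all_order all_algebra.
From mathcomp Require Import all_classical all_reals all_analysis.
From mathcomp Require Import measurable_realfun.
Set Implicit Arguments.
Unset Strict Implicit.
Unset Printing Implicit Defensive.
Import Order.TTheory GRing.Theory Num.Theory.
Import numFieldNormedType.Exports.

Local Open Scope classical_set_scope.
Local Open Scope ring_scope.
Local Open Scope ereal_scope.

(* A nonempty subset D of R^p as a type.  Measurable types are pointed, hence
   the nonemptiness proof. *)
Definition param_space (R : realType) (p : nat) (D : set 'rV[R]_p)
  (D0 : D !=set0) : Type := set_type D.

Section param_space_pointed.
Context {R : realType} {p : nat} (D : set 'rV[R]_p) (D0 : D !=set0).
HB.instance Definition _ := Choice.on (param_space D0).
HB.instance Definition _ := isPointed.Build (param_space D0)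
  (exist _ (projT1 (cid D0)) (mem_set (projT2 (cid D0)))).
End param_space_pointed.

(* D endowed with the sigma-field <<s B >>, which is B itself when B is a
   sigma-field. *)
Definition param_measurable (R : realType) (p : nat) (D : set 'rV[R]_p)
    (D0 : D !=set0) (B : set (set (param_space D0)))
    : measurableType (sigma_display B) :=
  g_sigma_algebraType B.

Definition is_density (R : realType) (d : measure_display)
    (X : measurableType d) (lambda : {measure set X -> \bar R})
    (mu : set X -> \bar R) (g : X -> R) : Prop :=
  [/\ measurable_fun setT g,
      forall x, (0 <= g x)%R
    & forall S, measurable S -> mu S = \int[lambda]_(x in S) (g x)%:E].

(* In this section, the sample size n and the index alpha are fixed, and
   q (x, theta) is the alpha-likelihood q_n^(alpha)(x | theta).  It is extended
   real valued because q_n^(0) = log f^n - n is -oo where f^n vanishes; [expeR]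
   sends -oo to 0. *)
Section alpha_likelihood.
Context {R : realType} {dX dT : measure_display}
  {X : measurableType dX} {T : measurableType dT}.
Variables (lambda : {measure set X -> \bar R}) (prior : {measure set T -> \bar R}).
Variable q : X * T -> \bar R.

Definition Qint (S : set X) (theta : T) : \bar R :=
  \int[lambda]_(x in S) expeR (q (x, theta)).

Definition Mint (S : set X) (A : set T) : \bar R :=
  \int[prior]_(theta in A) Qint S theta.

Definition mint (x : X) (A : set T) : \bar R :=
  \int[prior]_(theta in A) expeR (q (x, theta)).

(* density, with respect to lambda, of the R^(alpha)-marginal distribution *)
Definition marginal_density (x : X) : \bar R :=
  mint x setT / Mint setT setT.

(* [dflt] is the arbitrary value taken when the denominator is 0 or +oo *)
Definition alpha_posterior (dflt : X -> set T -> \bar R) (x : X) (A : set T)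
    : \bar R :=
  if 0 < mint x setT < +oo then mint x A / mint x setT else dflt x A.

(* Q(X | theta) prior(dtheta) / M(X, T) *)
Definition modified_prior (A : set T) : \bar R :=
  Mint setT A / Mint setT setT.

End alpha_likelihood.

Section merging.
Context {R : realType} {d : measure_display} {Omega : measurableType d}
  (P : probability Omega R) {dX : nat -> measure_display}
  {X : forall n, measurableType (dX n)}.
Variables (Xn : forall n, Omega -> X n) (g : forall n, X n -> R)
  (m : forall n, X n -> \bar R).

(* The value of the ratio where g vanishes is immaterial: g (Xn w) > 0 almost
   surely when g is the density of the law of Xn. *)
Definition merge_event (eps : R) (n : nat) : set Omega :=
  [set w | (expR (- (n%:R * eps)))%:E < m (Xn n w) / (g (Xn n w))%:E].

Definition merge_in_probability : Prop :=
  forall eps : R, (0 < eps)%R ->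
    (fun n => P (merge_event eps n)) @ \oo --> (1 : \bar R).

Definition merge_with_probability_one : Prop :=
  forall eps : R, (0 < eps)%R ->
    P [set w | \forall n \near \oo, merge_event eps n w] = 1.

End merging.

(* Main.v *)
Require Import Defs.
From HB Require Import structures.
From mathcomp Require Import all_boot all_order all_algebra.
From mathcomp Require Import all_classical all_reals all_analysis.
From mathcomp Require Import measurable_realfun.
From mathcomp Require Import lra.
Set Implicit Arguments.
Unset Strict Implicit.
Unset Printing Implicit Defensive.
Import Order.TTheory GRing.Theory Num.Theory.
Import numFieldNormedType.Exports.
Local Open Scope classical_set_scope.
Local Open Scope ring_scope.
Local Open Scope ereal_scope.

(* Write post(x) for the posterior mass of A^c, D for M(X, Theta).

   Posterior decay gives the test S = {post >= e^{-nr}}.  By Tonelli,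
   M(S^c, A^c) = int_{S^c} m(x, A^c) dx <= e^{-nr} D, so by Markov's inequality
   the part B of A^c where Q(S^c|theta) > e^{-nr/2} Q(X|theta) has modified
   prior at most e^{-nr/2}; C is the set where the reverse inequality holds.

   Conversely, let h(x) = (m(x, B) + 1_{S^c}(x) m(x, C)) / D, whose integral is
   at most e^{-n r1} + e^{-n r2} by Tonelli.  Where x is outside S,
   m(x)/g(x) > t and post(x) >= u, one has t u g(x) <= h(x) for almost every x,
   so this set has G-probability at most (e^{-n r1} + e^{-n r2}) / (t u).  With
   t = u = e^{-ns/4}, s = min(r1, r2), this is at most 2 e^{-ns/2}, which tends
   to 0 and is summable (Borel-Cantelli). *)

(** * Division and measurability in the extended reals *)

Lemma lte_divrMr (R : realType) (x y z : \bar R) : 0 < y -> y \is a fin_num ->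
  (x / y < z) = (x < z * y).
Proof. by case: y => // y y0 _; rewrite inver gt_eqF// lte_pdivrMr. Qed.

Lemma lee_divlMr (R : realType) (x y z : \bar R) : 0 < y -> y \is a fin_num ->
  (z <= x / y) = (z * y <= x).
Proof. by case: y => // y y0 _; rewrite inver gt_eqF// lee_pdivlMr. Qed.

Lemma lee_divrMr (R : realType) (x y z : \bar R) : 0 < y -> y \is a fin_num ->
  (x / y <= z) = (x <= z * y).
Proof. by case: y => // y y0 _; rewrite inver gt_eqF// lee_pdivrMr. Qed.

Lemma measurable_fun_expeR d (T : measurableType d) (R : realType)
    (f : T -> \bar R) :
  measurable_fun setT f -> measurable_fun setT (fun x => expeR (f x)).
Proof.
move=> mf.
(* Splitting off the two infinite values leaves only the real exponential of the finite part, which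
   is measurable. *)
have -> : (fun x => expeR (f x)) = (fun x => if f x == +oo then +oo else
    if f x == -oo then 0 else (expR (fine (f x)))%:E).
  by apply/funext => x; case: (f x).
apply: measurable_fun_ifT; [exact: measurable_fun_eqe|exact: measurable_cst|].
apply: measurable_fun_ifT; [exact: measurable_fun_eqe|exact: measurable_cst|].
apply/measurable_EFinP; apply: measurableT_comp => //.
exact: measurableT_comp mf.
Qed.

Lemma measurable_fun_inve_ge0 d (T : measurableType d) (R : realType)
    (f : T -> \bar R) : (forall x, 0 <= f x) ->
  measurable_fun setT f -> measurable_fun setT (fun x => (f x)^-1).
Proof.
move=> f0 mf.
(* The inverse sends 0 to [+oo] and [+oo] to 0; on positive reals it is the power function of
   exponent -1, known to be measurable. *)
have -> : (fun x => (f x)^-1) = (fun x => if f x == 0 then +oo else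
    if f x == +oo then 0 else ((fine (f x)) `^ (-1))%:E).
  apply/funext => x; have := f0 x; case: (f x) => //= r r0.
  by rewrite /inve eqe; case: ifPn => // _; rewrite powR_inv1.
apply: measurable_fun_ifT; [exact: measurable_fun_eqe|exact: measurable_cst|].
apply: measurable_fun_ifT; [exact: measurable_fun_eqe|exact: measurable_cst|].
apply/measurable_EFinP.
apply: (@measurableT_comp _ _ _ _ _ _ (fun r : R => r `^ (-1))%R).
  exact: measurable_powR.
exact: measurableT_comp mf.
Qed.

(** * Tonelli and the two integral bounds at a fixed sample size *)

Section one_sample_size.
Context {R : realType} {dX dT : measure_display}
  {X : measurableType dX} {T : measurableType dT}.
Variables (lambda : {sigma_finite_measure set X -> \bar R})
  (prior : {measure set T -> \bar R}) (q : X * T -> \bar R).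
Hypothesis prior_fin : prior setT < +oo.

(* [prior] as a sigma-finite measure, as Tonelli's theorem requires. *)
Let nu : set T -> \bar R := prior.
Let nu_fin : fin_num_fun nu. Proof. exact: lty_fin_num_fun. Qed.
HB.instance Definition _ := Measure.on nu.
HB.instance Definition _ := @Measure_isFinite.Build _ T _ nu nu_fin.

Hypothesis mq : measurable_fun setT q.

Let mexpq := measurable_fun_expeR mq.

(** Cutting the integrand off outside the strip over [A] turns the partial integral into a full
    section integral, to which Tonelli's measurability result applies. *)
Lemma measurable_fun_mint (A : set T) : measurable A ->
  measurable_fun setT (fun x => mint prior q x A).
Proof.
move=> mA; rewrite (_ : (fun x => _) =
    fubini_F nu ((fun z => expeR (q z)) \_ (setT `*` A))).
  apply: measurable_fun_fubini_tonelli_F => [|z].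
    apply/(measurable_restrictT _ _).1; first exact: measurableX.
    exact: measurable_funS mexpq.
  by rewrite patchE; case: ifP => // _; exact: expeR_ge0.
apply/funext => x; rewrite /mint integral_mkcond; apply: eq_integral => t _.
by rewrite !patchE in_setX in_setT.
Qed.

Lemma measurable_fun_Qint (S : set X) : measurable S ->
  measurable_fun setT (Qint lambda q S).
Proof.
move=> mS; rewrite (_ : Qint _ _ _ =
    fubini_G lambda ((fun z => expeR (q z)) \_ (S `*` setT))).
  apply: measurable_fun_fubini_tonelli_G => [|z].
    apply/(measurable_restrictT _ _).1; first exact: measurableX.
    exact: measurable_funS mexpq.
  by rewrite patchE; case: ifP => // _; exact: expeR_ge0.
apply/funext => t; rewrite /Qint integral_mkcond; apply: eq_integral => x _.
by rewrite !patchE in_setX in_setT andbT.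
Qed.

Lemma Qint_ge0 (S : set X) t : 0 <= Qint lambda q S t.
Proof. by apply: integral_ge0 => x _; exact: expeR_ge0. Qed.

Lemma mint_ge0 x (A : set T) : 0 <= mint prior q x A.
Proof. by apply: integral_ge0 => t _; exact: expeR_ge0. Qed.

(** Both sides are iterated integrals, in opposite orders, of the single function [k], the
    exponentiated likelihood cut off outside the rectangle of [S] and [A]. *)
Lemma Mint_tonelli (S : set X) (A : set T) : measurable S -> measurable A ->
  Mint lambda prior q S A = \int[lambda]_(x in S) mint prior q x A.
Proof.
move=> mS mA; rewrite /Mint [LHS]integral_mkcond [RHS]integral_mkcond.
pose k := (fun z => expeR (q z)) \_ (S `*` A).
transitivity (\int[prior]_t \int[lambda]_x k (x, t)).
  apply: eq_integral => t _; rewrite patchE /k /Qint; case: ifPn => tA.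
    rewrite integral_mkcond; apply: eq_integral => x _.
    by rewrite !patchE in_setX /= tA andbT.
  by rewrite integral0_eq// => x _; rewrite patchE in_setX/= (negPf tA) andbF.
rewrite -(@fubini_tonelli _ _ _ _ _ lambda nu); last 2 first.
- apply/(measurable_restrictT _ _).1; first exact: measurableX.
  exact: measurable_funS mexpq.
- by move=> z; rewrite /k patchE; case: ifP => // _; exact: expeR_ge0.
apply: eq_integral => x _; rewrite patchE /k /mint; case: ifPn => xS.
  rewrite integral_mkcond; apply: eq_integral => t _.
  by rewrite !patchE in_setX /= xS.
by rewrite integral0_eq// => t _; rewrite patchE in_setX/= (negPf xS).
Qed.

Hypothesis M_fin : 0 < Mint lambda prior q setT setT < +oo.

(** By Tonelli the integral over x of the total mass is M(X, Theta), which is finite, and an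
    integrable function is finite almost everywhere. Hence, up to a null set, the posterior takes
    its default value only where the total mass is 0. *)
Lemma mint_ae_fin : {ae lambda, forall x, mint prior q x setT \is a fin_num}.
Proof.
have : lambda.-integrable setT (fun x => mint prior q x setT).
  apply/integrableP; split; first exact: measurable_fun_mint.
  under eq_integral do rewrite gee0_abs ?mint_ge0//.
  by rewrite -Mint_tonelli//; case/andP: M_fin.
by move/(integrable_ae measurableT); apply: filterS => x; exact.
Qed.

Lemma measurable_fun_alpha_posterior (dflt : X -> set T -> \bar R) (A : set T) :
  measurable A -> measurable_fun setT (dflt ^~ A) ->
  measurable_fun setT (fun x => alpha_posterior prior q dflt x A).
Proof.
move=> mA mdflt; rewrite /alpha_posterior; apply: measurable_fun_ifT => //.
  apply: measurable_and.
    apply: measurable_fun_lte; [exact: measurable_cst|exact: measurable_fun_mint].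
  apply: measurable_fun_lte; [exact: measurable_fun_mint|exact: measurable_cst].
apply: emeasurable_funM; first exact: measurable_fun_mint.
apply: measurable_fun_inve_ge0; last exact: measurable_fun_mint.
by move=> x; exact: mint_ge0.
Qed.

Lemma measurable_fun_marginal_density :
  measurable_fun setT (marginal_density lambda prior q).
Proof.
apply: emeasurable_funM; first exact: measurable_fun_mint.
exact: measurable_cst.
Qed.

(** With B the set being bounded and D = M(X, Theta), the chain is c M(X, B) <= M(S^c, B) <= M(S^c,
    E) <= b D. The last link integrates m(x, E) <= b m(x, Theta) over S^c; dividing by c D
    concludes. *)
Lemma modified_prior_le_posterior (dflt : X -> set T -> \bar R) (E : set T)
    (S : set X) (b c : R) :
  measurable E -> measurable S -> (0 <= b)%R -> (0 < c)%R ->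
  (forall x, ~ S x -> alpha_posterior prior q dflt x E < b%:E) ->
  modified_prior lambda prior q (E `&` [set t |
      c%:E * Qint lambda q setT t < Qint lambda q (~` S) t]) <= (b / c)%:E.
Proof.
move=> mE mS b0 c0 postS; set B := _ `&` _.
have mCS : measurable (~` S) by exact: measurableC.
have mB : measurable B.
  apply: measurableI => //; rewrite -[X in measurable X]setTI.
  apply: emeasurable_fun_lt => //; last exact: measurable_fun_Qint.
  by apply: emeasurable_funM => //; exact: measurable_fun_Qint.
case/andP: (M_fin) => M0 Moo.
have [D D0 DE] : exists2 D : R, (0 < D)%R & Mint lambda prior q setT setT = D%:E.
  by case: (Mint _ _ _ _ _) M0 Moo => // D; exists D.
have cB : c%:E * Mint lambda prior q setT B <= Mint lambda prior q (~` S) B.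
  rewrite /Mint -ge0_integralZl//; last 3 first.
  - by apply: measurable_funTS; exact: measurable_fun_Qint.
  - by move=> t _; exact: Qint_ge0.
  - by rewrite lee_fin ltW.
  apply: ge0_le_integral => //.
  - by move=> t _; rewrite mule_ge0 ?Qint_ge0 ?lee_fin ?ltW.
  - apply: measurable_funTS; apply: emeasurable_funM => //; exact: measurable_fun_Qint.
  - by apply: measurable_funTS; exact: measurable_fun_Qint.
  - by move=> t [_ /ltW].
have BE : Mint lambda prior q (~` S) B <= Mint lambda prior q (~` S) E.
  apply: ge0_subset_integral => //.
  - by apply: measurable_funTS; exact: measurable_fun_Qint.
  - by move=> t _; exact: Qint_ge0.
  - by move=> t [].
have EM : Mint lambda prior q (~` S) E <= (b * D)%:E.
  rewrite EFinM -DE !Mint_tonelli// -ge0_integralZl//; last 2 first.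
  - exact: measurable_fun_mint.
  - by move=> x _; exact: mint_ge0.
  have mbm : measurable_fun setT (fun x => b%:E * mint prior q x setT).
    by apply: emeasurable_funM => //; exact: measurable_fun_mint.
  apply: (@le_trans _ _ (\int[lambda]_(x in ~` S) (b%:E * mint prior q x setT))).
    apply: ae_ge0_le_integral => //.
    - by move=> x _; exact: mint_ge0.
    - by apply: measurable_funTS; exact: measurable_fun_mint.
    - by move=> x _; rewrite mule_ge0 ?mint_ge0 ?lee_fin.
    - exact: measurable_funTS.
    apply: filterS mint_ae_fin => x mfin /postS.
    have mEle : mint prior q x E <= mint prior q x setT.
      apply: ge0_subset_integral => //; last by move=> *; exact: expeR_ge0.
      by have := measurable_fun_pair2 x mexpq.
    rewrite /alpha_posterior ltey_eq mfin andbT.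
    (* Where the total mass is 0 the posterior is the arbitrary default and [postS] says nothing
       about m(x, E); monotonicity then forces m(x, E) to be 0 as well. *)
    have [m0|m0] := ltP 0 (mint prior q x setT).
      by rewrite lte_divrMr// => /ltW.
    by rewrite (le_trans mEle)// (le_trans m0)// mule_ge0 ?mint_ge0// lee_fin.
  apply: ge0_subset_integral => //.
  by move=> x _; rewrite mule_ge0 ?mint_ge0 ?lee_fin.
have := le_trans cB (le_trans BE EM); rewrite /modified_prior DE.
have -> : D%:E^-1 = (D^-1)%:E by rewrite inver gt_eqF.
rewrite lee_pdivrMr// muleC -lee_pdivlMr// => /le_trans; apply.
by rewrite -EFinM lee_fin mulrAC.
Qed.

(** The inequality t u g(x) <= (m(x, B) + m(x, C)) / D holds for almost every x in W and is
    integrated over W. Since W avoids S, the C term is at most M(S^c, C) <= c D, while the B term is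
    at most M(X, B) <= b D. *)
Lemma density_posterior_le (mu : set X -> \bar R) (g : X -> R)
    (dflt : X -> set T -> \bar R) (E B C : set T) (S : set X) (b c t u : R) :
  is_density lambda mu g ->
  measurable E -> measurable_fun setT (dflt ^~ E) -> measurable B ->
  measurable C -> measurable S -> E `<=` B `|` C ->
  (0 <= c)%R -> (0 < t)%R -> (0 < u)%R ->
  modified_prior lambda prior q B <= b%:E ->
  (forall theta, C theta ->
    Qint lambda q (~` S) theta <= c%:E * Qint lambda q setT theta) ->
  let W := [set x | [/\ ~ S x, t%:E < marginal_density lambda prior q x / (g x)%:E
               & u%:E <= alpha_posterior prior q dflt x E]] in
  measurable W /\ mu W <= ((b + c) / (t * u))%:E.
Proof.
move=> [mg g0 muE] mE mdflt mB mC mS EBC c0 t0 u0 Bb Cc W.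
have mCS : measurable (~` S) by exact: measurableC.
have mm := measurable_fun_marginal_density.
have mpost := measurable_fun_alpha_posterior mE mdflt.
have mgE : measurable_fun setT (fun x => (g x)%:E) by exact/measurable_EFinP.
have mW : measurable W.
  have -> : W = ~` S `&` ([set x | t%:E < marginal_density lambda prior q x / (g x)%:E]
      `&` [set x | u%:E <= alpha_posterior prior q dflt x E]).
    by apply/seteqP; split => x [] => [|? []].
  apply: measurableI => //; apply: measurableI.
    rewrite -[X in measurable X]setTI; apply: emeasurable_fun_o_infty => //.
    apply: emeasurable_funM => //; exact: measurable_fun_inve_ge0.
  by rewrite -[X in measurable X]setTI; apply: emeasurable_fun_c_infty.
split=> //.
case/andP: (M_fin) => M0 Moo.
have [D D0 DE] : exists2 D : R, (0 < D)%R & Mint lambda prior q setT setT = D%:E.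
  by case: (Mint _ _ _ _ _) M0 Moo => // D; exists D.
have DVE : D%:E^-1 = (D^-1)%:E by rewrite inver gt_eqF.
have D'0 : (0 < D^-1)%R by rewrite invr_gt0.
have mmB := measurable_fun_mint mB; have mmC := measurable_fun_mint mC.
have msub (F G : set T) x : measurable F -> measurable G -> F `<=` G ->
    mint prior q x F <= mint prior q x G.
  move=> mF mG FG; apply: ge0_subset_integral => //; last by move=> *; exact: expeR_ge0.
  by apply: measurable_funTS; have := measurable_fun_pair2 x mexpq.
have tuW : (t * u)%:E * mu W
    <= (D^-1)%:E * (\int[lambda]_(x in W) (mint prior q x B + mint prior q x C)).
  rewrite muE// -!ge0_integralZl//; last 6 first.
  - by apply: measurable_funTS; exact: emeasurable_funD.
  - by move=> x _; rewrite adde_ge0 ?mint_ge0.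
  - by rewrite lee_fin ltW.
  - exact: measurable_funTS.
  - by move=> x _; rewrite lee_fin.
  - by rewrite lee_fin ltW// mulr_gt0.
  apply: ae_ge0_le_integral => //.
  - by move=> x _; rewrite -EFinM lee_fin mulr_ge0// ltW// mulr_gt0.
  - by apply: measurable_funTS; apply: emeasurable_funM.
  - by move=> x _; apply: mule_ge0; [rewrite lee_fin ltW|rewrite adde_ge0 ?mint_ge0].
  - by apply: measurable_funTS; apply: emeasurable_funM => //; exact: emeasurable_funD.
  apply: filterS (mint_ae_fin) => x mfin [_ tm um].
  (* A zero total mass cannot occur on W: the marginal density would be 0, hence so would its ratio
     to g(x), even if g(x) = 0, against [tm] and t > 0. *)
  have [m0|m0] := ltP 0 (mint prior q x setT); last first.
    have mx0 : mint prior q x setT = 0.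
      by apply/eqP; rewrite eq_le m0 mint_ge0.
    move: tm; rewrite /marginal_density mx0 !mul0e lte_fin => /lt_trans.
    by move=> /(_ _ t0); rewrite ltxx.
  move: um; rewrite /alpha_posterior m0 ltey_eq mfin.
  move: tm; rewrite /marginal_density DE DVE => tm.
  rewrite lee_divlMr// => um.
  (* Subadditivity, obtained by covering E with the disjoint sets B and C minus B. *)
  have EB : mint prior q x E <= mint prior q x B + mint prior q x C.
    have mCB : measurable (C `\` B) by exact: measurableD.
    rewrite (le_trans (msub _ (B `|` (C `\` B)) _ mE _ _))//.
    - exact: measurableU.
    - by rewrite setUDr setDv setD0.
    rewrite {1}/mint ge0_integral_setU//; last 3 first.
    - by apply: measurable_funTS; have := measurable_fun_pair2 x mexpq.
    - by move=> *; exact: expeR_ge0.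
    - by rewrite disj_set2E setDE setIA setIAC setICr set0I.
    by rewrite leeD2l//; apply: msub.
  (* Where g(x) = 0 the ratio in [tm] cannot be multiplied out, but the left side is then 0. *)
  have gm : (t * g x)%:E <= (D^-1)%:E * mint prior q x setT.
    have [gx|gx] := ltP 0%R (g x).
      by rewrite [leRHS]muleC; move: tm; rewrite inver gt_eqF// lte_pdivlMr// => /ltW.
    have -> : g x = 0%R by apply/eqP; rewrite eq_le gx g0.
    by rewrite mulr0 mule_ge0 ?mint_ge0// lee_fin ltW.
  apply: (@le_trans _ _ (u%:E * ((D^-1)%:E * mint prior q x setT))).
    by rewrite -EFinM mulrAC mulrC EFinM lee_wpmul2l// lee_fin ltW.
  by rewrite muleCA lee_wpmul2l ?lee_fin ?(ltW D'0)// (le_trans um).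
(* W is enlarged to the whole space for the B term, but only to S^c for the C term, where the test
   bound is available. *)
have ISC : \int[lambda]_(x in W) (mint prior q x B + mint prior q x C)
    <= Mint lambda prior q setT B + Mint lambda prior q (~` S) C.
  rewrite ge0_integralD//; last 4 first.
  - by move=> *; exact: mint_ge0.
  - exact: measurable_funTS.
  - by move=> *; exact: mint_ge0.
  - exact: measurable_funTS.
  rewrite !Mint_tonelli// leeD//; apply: ge0_subset_integral => //.
  - by move=> *; exact: mint_ge0.
  - exact: measurable_funTS.
  - by move=> *; exact: mint_ge0.
  - by move=> x [].
have CM : Mint lambda prior q (~` S) C <= (c * D)%:E.
  apply: (@le_trans _ _ (\int[prior]_(theta in C) (c%:E * Qint lambda q setT theta))).
    apply: ge0_le_integral => //.
    - by move=> *; exact: Qint_ge0.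
    - by apply: measurable_funTS; exact: measurable_fun_Qint.
    - by apply: measurable_funTS; apply: emeasurable_funM => //; exact: measurable_fun_Qint.
  rewrite ge0_integralZl//; last 2 first.
  - by apply: measurable_funTS; exact: measurable_fun_Qint.
  - by move=> *; exact: Qint_ge0.
  rewrite EFinM lee_wpmul2l ?lee_fin// -DE; apply: ge0_subset_integral => //.
  - exact: measurable_fun_Qint.
  - by move=> *; exact: Qint_ge0.
have BM : Mint lambda prior q setT B <= (b * D)%:E.
  by move: Bb; rewrite /modified_prior DE DVE lee_pdivrMr// -EFinM.
have : (t * u)%:E * mu W <= (b + c)%:E.
  apply: (le_trans tuW).
  have -> : (b + c)%:E = (D^-1)%:E * ((b * D)%:E + (c * D)%:E).
    by rewrite -EFinD -EFinM -mulrDl mulrC mulfK// gt_eqF.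
  by rewrite lee_wpmul2l ?lee_fin ?(ltW D'0)// (le_trans ISC)// leeD.
by rewrite muleC -lee_pdivlMr ?mulr_gt0// EFinM.
Qed.

End one_sample_size.

(** * Limits superior of events, Borel-Cantelli and complements *)

(* Allows ignoring the index 0, about which the theorem assumes nothing. *)
Lemma lim_sup_setS (T : Type) (F : (set T)^nat) :
  lim_sup_set F = lim_sup_set (fun n => F n.+1).
Proof.
apply/seteqP; split => x Fx n _.
  by have [//|[//|j] /= nj Fj] := Fx n.+1; exists j.
by have [//|j /= nj Fj] := Fx n; exists j.+1 => //=; exact: leqW.
Qed.

(** Converts an eventual event, as in merging with probability one, into the limit superior of its
    failures, which can be joined to other null events. *)
Lemma eventuallyE_lim_sup_set (T : Type) (F : (set T)^nat) :
  [set x | \forall n \near \oo, F n x] = ~` lim_sup_set (fun n => ~` F n).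
Proof.
apply/seteqP; split => x.
  by move=> [N _ NF] /(_ N Logic.I)[n /NF].
move=> /existsNP[N /not_implyP[_ NF]]; exists N => // n Nn.
by apply: contrapT => nF; apply: NF; exists n.
Qed.

Lemma sub_lim_sup_set (T : Type) (F G : (set T)^nat) :
  (forall n, F n `<=` G n) -> lim_sup_set F `<=` lim_sup_set G.
Proof. by move=> FG x Fx n _; have [//|j nj /FG] := Fx n; exists j. Qed.

(** By complements: two properties each hold eventually exactly when their conjunction does. *)
Lemma lim_sup_setU (T : Type) (F G : (set T)^nat) :
  lim_sup_set (fun n => F n `|` G n) = lim_sup_set F `|` lim_sup_set G.
Proof.
apply: setC_inj; rewrite setCU.
have E (H : (set T)^nat) : ~` lim_sup_set H = [set x | \forall n \near \oo, ~ H n x].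
  rewrite (eventuallyE_lim_sup_set (fun n => ~` H n)); congr (~` lim_sup_set _).
  by apply/funext => n; rewrite setCK.
rewrite !E; apply/seteqP; split => x /=.
  by move=> FG; split; apply: filterS FG => n FGn ?; apply: FGn; [left|right].
by move=> [nF nG]; apply: filterS2 nF nG => n Fn Gn [].
Qed.

Lemma measurable_lim_sup_set d (T : measurableType d) (F : (set T)^nat) :
  (forall n, (0 < n)%N -> measurable (F n)) -> measurable (lim_sup_set F).
Proof.
move=> mF; rewrite lim_sup_setS; apply: bigcap_measurable => // n _.
by apply: bigcup_measurable => k _; exact: mF.
Qed.

(** First Borel-Cantelli lemma: the geometric majorant makes the measures summable. *)
Lemma lim_sup_set_geometric0 d (T : measurableType d) (R : realType)
    (mu : {measure set T -> \bar R}) (F : (set T)^nat) (a z : R) :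
  (0 <= a)%R -> (0 < z < 1)%R ->
  (forall n, (0 < n)%N -> measurable (F n)) ->
  (forall n, (0 < n)%N -> mu (F n) <= (a * z ^+ n)%:E) ->
  mu (lim_sup_set F) = 0.
Proof.
move=> a0 /andP[z0 z1] mF muF; rewrite lim_sup_setS.
apply: lim_sup_set_cvg0 => [n|]; first exact: mF.
apply: (@le_lt_trans _ _ (a / (1 - z))%:E); last exact: ltry.
apply: lime_le; first exact: is_cvg_nneseries.
apply: nearW => n.
apply: (@le_trans _ _ (series (geometric a z) n)%:E).
  rewrite /series/= -sumEFin lee_sum// => k _.
  (* After the shift the term is a z^(k+1), which is at most a z^k, so the geometric sum a / (1 - z)
     is a sufficient bound. *)
  rewrite (le_trans (muF k.+1 isT))// lee_fin ler_wpM2l//.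
  by rewrite exprS ler_piMl ?exprn_ge0 ?ltW.
have nz1 : (`|z| < 1)%R by rewrite gtr0_norm.
rewrite lee_fin -(cvg_lim _ (cvg_geometric_series nz1))//.
apply: nondecreasing_cvgn_le; last exact: is_cvg_geometric_series.
apply: nondecreasing_series => k _ _.
by rewrite mulr_ge0// exprn_ge0// ltW.
Qed.

(** The complement rule requires measurability, granted from index 1 on, so the two sequences are
    compared eventually rather than termwise. *)
Lemma probability_setC_cvg d (T : measurableType d) (R : realType)
    (P : probability T R) (F : (set T)^nat) (l : R) :
  (forall n, (0 < n)%N -> measurable (F n)) ->
  (fun n => P (F n)) @ \oo --> l%:E ->
  (fun n => P (~` F n)) @ \oo --> (1 - l)%:E.
Proof.
move=> mF Fl; have : (fun n => 1 - P (F n)) @ \oo --> (1 - l)%:E.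
  by rewrite EFinB; apply: cvgeB => //; exact: cvg_cst.
apply: cvg_trans; apply: near_eq_cvg; exists 1%N => // n /= n0.
by rewrite probability_setC//; exact: mF.
Qed.

Theorem theorem3p3
  (R : realType)
  (d : measure_display) (Omega : measurableType d) (P : probability Omega R)
  (dX : nat -> measure_display) (X : forall n, measurableType (dX n))
  (Xn : forall n, {mfun Omega >-> X n})
  (lambda : forall n, {sigma_finite_measure set (X n) -> \bar R})
  (g : forall n, X n -> R)
  (g_density : forall n, (0 < n)%N ->
     is_density (lambda n) (distribution P (Xn n)) (g n))
  (p : nat) (Theta : nat -> set 'rV[R]_p) (Theta0 : forall n, Theta n !=set0)
  (BTheta : forall n, set (set (param_space (Theta0 n))))
  (BTheta_sigma : forall n, (0 < n)%N -> sigma_algebra setT (BTheta n))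
  (prior : forall n, {measure set (param_measurable (BTheta n)) -> \bar R})
  (prior_le1 : forall n, (0 < n)%N -> prior n setT <= 1)
  (F : forall n, param_measurable (BTheta n) -> probability (X n) R)
  (f : forall n, param_measurable (BTheta n) -> X n -> R)
  (f_density : forall n (theta : param_measurable (BTheta n)), (0 < n)%N ->
     is_density (lambda n) (F n theta) (f n theta))
  (q : R -> forall n, X n * param_measurable (BTheta n) -> \bar R)
  (q_measurable : forall (a : R) n, (0 <= a)%R -> (0 < n)%N ->
     measurable_fun setT (q a n))
  (q_lim0 : forall n (x : X n) (theta : param_measurable (BTheta n)),
     (0 < n)%N -> q a n (x, theta) @[a --> (0 : R)^'+] --> q 0%R n (x, theta))
  (q0E : forall n (x : X n) (theta : param_measurable (BTheta n)),
     (0 < n)%N -> q 0%R n (x, theta) = lne (f n theta x)%:E - n%:R%:E)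
  (alpha : R) (alpha_ge0 : (0 <= alpha)%R)
  (M_fin : forall n, (0 < n)%N ->
     0 < Mint (lambda n) (prior n) (q alpha n) setT setT < +oo)
  (Q_fin : forall n (theta : param_measurable (BTheta n)), (0 < n)%N ->
     0 < Qint (lambda n) (q alpha n) setT theta < +oo)
  (dflt : forall n, X n -> set (param_measurable (BTheta n)) -> \bar R)
  (dflt_measurable : forall n (E : set (param_measurable (BTheta n))),
     (0 < n)%N -> measurable E -> measurable_fun setT (fun x : X n => dflt n x E))
  (A : forall n, set (param_measurable (BTheta n)))
  (A_measurable : forall n, (0 < n)%N -> measurable (A n)) :
  (merge_in_probability P Xn g
     (fun n => marginal_density (lambda n) (prior n) (q alpha n)) ->
   ((exists2 r : R, (0 < r)%R &
       (fun n => P [set w | alpha_posterior (prior n) (q alpha n) (dflt n)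
                              (Xn n w) (~` A n)
                            < (expR (- (n%:R * r)))%:E])
         @ \oo --> (1 : \bar R))
    <->
    (exists (r1 r2 : R) (B C : forall n, set (param_measurable (BTheta n))),
       [/\ (0 < r1)%R /\ (0 < r2)%R,
           forall n, (0 < n)%N -> measurable (B n) /\ measurable (C n),
           forall n, (0 < n)%N -> A n `|` B n `|` C n = setT,
           forall n, (0 < n)%N ->
             modified_prior (lambda n) (prior n) (q alpha n) (B n)
             <= (expR (- (n%:R * r1)))%:E
         & exists S : forall n, set (X n),
             [/\ forall n, (0 < n)%N -> measurable (S n),
                 (fun n => distribution P (Xn n) (S n)) @ \oo --> (0 : \bar R)
               & forall n, (0 < n)%N ->
                   ereal_sup [set Qint (lambda n) (q alpha n) (~` S n) theta
                                  / Qint (lambda n) (q alpha n) setT theta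
                             | theta in C n]
                   <= (expR (- (n%:R * r2)))%:E]])))
  /\
  (merge_with_probability_one P Xn g
     (fun n => marginal_density (lambda n) (prior n) (q alpha n)) ->
   ((exists2 r : R, (0 < r)%R &
       P (lim_sup_set (fun n =>
            [set w | (expR (- (n%:R * r)))%:E
                     <= alpha_posterior (prior n) (q alpha n) (dflt n)
                          (Xn n w) (~` A n)])) = 0)
    <->
    (exists (r1 r2 : R) (B C : forall n, set (param_measurable (BTheta n))),
       [/\ (0 < r1)%R /\ (0 < r2)%R,
           forall n, (0 < n)%N -> measurable (B n) /\ measurable (C n),
           forall n, (0 < n)%N -> A n `|` B n `|` C n = setT,
           forall n, (0 < n)%N ->
             modified_prior (lambda n) (prior n) (q alpha n) (B n)
             <= (expR (- (n%:R * r1)))%:E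
         & exists S : forall n, set (X n),
             [/\ forall n, (0 < n)%N -> measurable (S n),
                 P (lim_sup_set (fun n => Xn n @^-1` S n)) = 0
               & forall n, (0 < n)%N ->
                   ereal_sup [set Qint (lambda n) (q alpha n) (~` S n) theta
                                  / Qint (lambda n) (q alpha n) setT theta
                             | theta in C n]
                   <= (expR (- (n%:R * r2)))%:E]]))).
Proof.

(* Finiteness and measurability of the objects in the theorem *)
have prior_fin n : (0 < n)%N -> prior n setT < +oo.
  by move=> n0; rewrite (le_lt_trans (prior_le1 n n0))// ltry.
pose post n x := alpha_posterior (prior n) (q alpha n) (dflt n) x (~` A n).
have mpost n : (0 < n)%N -> measurable_fun setT (post n).
  move=> n0; have mA := measurableC (A_measurable n n0).
  have mq := q_measurable alpha n alpha_ge0 n0.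
  exact: (measurable_fun_alpha_posterior (prior_fin n n0) mq mA (dflt_measurable n _ n0 mA)).
pose m n := marginal_density (lambda n) (prior n) (q alpha n).
(* This level set of the posterior mass of the complement of [A n] is the test S_n used for both
   (A3) and (A3)*. *)
pose S0 (r : R) n := [set x | (expR (- (n%:R * r)))%:E <= post n x].
have mS0 (r : R) n : (0 < n)%N -> measurable (S0 r n).
  move=> n0; rewrite -[X in measurable X]setTI.
  by apply: emeasurable_fun_c_infty => //; exact: mpost.
have Qfin n t : (0 < n)%N -> Qint (lambda n) (q alpha n) setT t \is a fin_num.
  by move=> n0; have /andP[Q0 Qoo] := Q_fin n t n0; rewrite gt0_fin_numE.
have mXn n (Y : set (X n)) : measurable Y -> measurable (Xn n @^-1` Y).
  by move=> mY; rewrite -[X in measurable X]setTI; exact: measurable_funPT.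
have mmerge (r : R) n : (0 < n)%N -> measurable (merge_event Xn g m r n).
  move=> n0; have [mg g0 _] := g_density n n0.
  have mq := q_measurable alpha n alpha_ge0 n0.
  apply: (mXn n [set x | (expR (- (n%:R * r)))%:E < m n x / (g n x)%:E]).
  rewrite -[X in measurable X]setTI; apply: emeasurable_fun_o_infty => //.
  apply: emeasurable_funM; first exact: (measurable_fun_marginal_density _ (prior_fin n n0) mq).
  by apply: measurable_fun_inve_ge0 => //; exact/measurable_EFinP.

(* From posterior decay to the sets B_n and C_n, common to both parts *)
have fwd (r : R) : (0 < r)%R -> exists (r1 r2 : R) B C,
    [/\ (0 < r1)%R /\ (0 < r2)%R,
        forall n, (0 < n)%N -> measurable (B n) /\ measurable (C n),
        forall n, (0 < n)%N -> A n `|` B n `|` C n = setT,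
        forall n, (0 < n)%N ->
          modified_prior (lambda n) (prior n) (q alpha n) (B n)
          <= (expR (- (n%:R * r1)))%:E
      & forall n, (0 < n)%N ->
          ereal_sup [set Qint (lambda n) (q alpha n) (~` S0 r n) theta
                         / Qint (lambda n) (q alpha n) setT theta
                    | theta in C n]
          <= (expR (- (n%:R * r2)))%:E].
  (* Halving the rate shares e^{-nr} equally between the Markov threshold [c n] and the resulting
     bound e^{-nr} / c_n = e^{-nr/2} on the modified prior, so r1 = r2 = r/2. *)
  move=> r0; pose c n : R := expR (- (n%:R * (r / 2))).
  pose D n := [set t | (c n)%:E * Qint (lambda n) (q alpha n) setT t
                       < Qint (lambda n) (q alpha n) (~` S0 r n) t].
  have mD n : (0 < n)%N -> measurable (D n).
    move=> n0; have mq := q_measurable alpha n alpha_ge0 n0.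
    have mQ := measurable_fun_Qint (lambda n) mq.
    rewrite -[X in measurable X]setTI; apply: emeasurable_fun_lt => //.
      by apply: emeasurable_funM => //; exact: mQ.
    by apply: mQ; apply: measurableC; exact: mS0.
  exists (r / 2)%R, (r / 2)%R, (fun n => ~` A n `&` D n), (fun n => ~` D n); split.
  - by rewrite divr_gt0.
  - move=> n n0; split; last exact: measurableC (mD _ n0).
    by apply: measurableI; [exact: measurableC (A_measurable n n0)|exact: mD].
  - move=> n n0; apply/seteqP; split => // t _.
    by have [At|At] := pselect (A n t); have [Dt|Dt] := pselect (D n t);
      [left;left|left;left|left;right|right].
  - move=> n n0; have mA := measurableC (A_measurable n n0).
    have := modified_prior_le_posterior (prior_fin n n0)
      (q_measurable alpha n alpha_ge0 n0) (M_fin n n0) mA (mS0 r n n0)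
      (expR_ge0 (- (n%:R * r))) (expR_gt0 (- (n%:R * (r / 2)))).
    have -> : (expR (- (n%:R * r)) / expR (- (n%:R * (r / 2))) =
        expR (- (n%:R * (r / 2))))%R.
      by rewrite -expRN -expRD; congr expR; lra.
    by apply => x /negP; rewrite -ltNge => pS; exact: pS.
  - move=> n n0; apply: ub_ereal_sup => _ [t /negP + <-].
    rewrite -leNgt lee_divrMr//; last exact: Qfin.
    by have /andP[] := Q_fin n t n0.

(* From the sets B_n, C_n, S_n to posterior decay, common to both parts *)
have bwd (r1 r2 : R) (B C : forall n, set (param_measurable (BTheta n)))
    (S : forall n, set (X n)) :
    (0 < r1)%R /\ (0 < r2)%R ->
    (forall n, (0 < n)%N -> measurable (B n) /\ measurable (C n)) ->
    (forall n, (0 < n)%N -> A n `|` B n `|` C n = setT) ->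
    (forall n, (0 < n)%N ->
       modified_prior (lambda n) (prior n) (q alpha n) (B n)
       <= (expR (- (n%:R * r1)))%:E) ->
    (forall n, (0 < n)%N -> measurable (S n)) ->
    (forall n, (0 < n)%N ->
       ereal_sup [set Qint (lambda n) (q alpha n) (~` S n) theta
                      / Qint (lambda n) (q alpha n) setT theta
                 | theta in C n]
       <= (expR (- (n%:R * r2)))%:E) ->
    exists (r z : R) (W : (set Omega)^nat),
      [/\ (0 < r)%R, (0 < z < 1)%R, forall n, (0 < n)%N -> measurable (W n),
          forall n, (0 < n)%N -> P (W n) <= (2 * z ^+ n)%:E
        & forall n, Xn n @^-1` S0 r n
            `<=` Xn n @^-1` S n `|` ~` merge_event Xn g m r n `|` W n].
  move=> [r1_gt0 r2_gt0] mBC ABC Br1 mS Cr2.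
  pose s := Num.min r1 r2; have s0 : (0 < s)%R by rewrite lt_min r1_gt0.
  (* The thresholds t and u both equal e^{-nr}; dividing by their product costs a factor e^{ns/2},
     which leaves e^{-ns/2} out of e^{-ns}. *)
  pose r : R := (s / 4)%R.
  (* What remains of a slow posterior once failures of the test and of merging are set aside. *)
  pose W n := Xn n @^-1` [set x | [/\ ~ S n x,
    (expR (- (n%:R * r)))%:E < m n x / (g n x)%:E
    & (expR (- (n%:R * r)))%:E <= post n x]].
  have Wle n : (0 < n)%N ->
      measurable (W n) /\ P (W n) <= (2 * expR (- (s / 2)) ^+ n)%:E.
    move=> n0; have mA := measurableC (A_measurable n n0); have [mB mC] := mBC n n0.
    have ABCn : ~` A n `<=` B n `|` C n.
      move=> t At; have : (A n `|` B n `|` C n) t by rewrite ABC.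
      by move=> [[//|Bt]|Ct]; [left|right].
    have := density_posterior_le (prior_fin n n0) (q_measurable alpha n alpha_ge0 n0)
      (M_fin n n0) (g_density n n0) mA (dflt_measurable n _ n0 mA) mB mC (mS n n0) ABCn
      (expR_ge0 (- (n%:R * r2))) (expR_gt0 (- (n%:R * r)))
      (expR_gt0 (- (n%:R * r))) (Br1 n n0).
    case=> [t Ct|mW muW].
      rewrite -lee_divrMr//; [|by have /andP[] := Q_fin n t n0|exact: Qfin].
      by apply: le_trans (Cr2 n n0); apply: ereal_sup_ubound; exists t.
    split; first exact: mXn.
    (* The bound is put in the form 2 z^n with z = e^{-s/2}, which serves both for convergence to 0
       and for summability. *)
    apply: (le_trans muW); rewrite lee_fin -expRM_natl -expRD.
    rewrite ler_pdivrMr ?expR_gt0// -mulrA -expRD.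
    rewrite [X in (_ <= _ * expR X)%R](_ : _ = - (n%:R * s))%R; last first.
      by rewrite /r; lra.
    have le_s x : (s <= x)%R -> (expR (- (n%:R * x)) <= expR (- (n%:R * s)))%R.
      by move=> sx; rewrite ler_expR lerN2 ler_wpM2l.
    by rewrite [leRHS]mulr_natl mulr2n lerD// le_s// ge_min lexx ?orbT.
  exists r, (expR (- (s / 2))), W; split.
  - by rewrite divr_gt0.
  - by rewrite expR_gt0 expR_lt1 oppr_lt0 divr_gt0.
  - by move=> n /Wle[].
  - by move=> n /Wle[].
  - move=> n w pw; have [Sw|Sw] := pselect (S n (Xn n w)); first by left; left.
    have [mw|mw] := pselect (merge_event Xn g m r n w); last by left; right.
    by right.
have setC_post (r : R) n : ~` [set w | post n (Xn n w) < (expR (- (n%:R * r)))%:E]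
    = Xn n @^-1` S0 r n.
  by apply/seteqP; split => w; rewrite /S0/= leNgt => /negP.

(* Part (1): convergence in probability *)
split.
  move=> merge; split.
    move=> [r r0 post1]; have [r1 [r2 [B [C [h1 h2 h3 h4 h5]]]]] := fwd r r0.
    exists r1, r2, B, C; split => //; exists (S0 r); split => //.
      exact: mS0.
    (* The rejection event of [S0 r] is the complement of the event whose probability tends to 1. *)
    rewrite [X in X @ _ --> _](_ : _ = fun n => P (~` [set w |
        post n (Xn n w) < (expR (- (n%:R * r)))%:E])); last first.
      by apply/funext => n; rewrite setC_post.
    rewrite -[0](_ : (1 - 1)%:E = _); last by rewrite subrr.
    apply: probability_setC_cvg => // n n0; rewrite -[X in measurable X]setCK.
    by apply: measurableC; rewrite setC_post; apply: mXn; exact: mS0.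
  move=> [r1 [r2 [B [C [h1 h2 h3 h4 [S [mS S0' h5]]]]]]].
  have [r [z [W [r0 z01 mW PW sub]]]] := bwd _ _ _ _ _ h1 h2 h3 h4 mS h5.
  exists r => //.
  rewrite [X in X @ _ --> _](_ : _ = fun n => P (~` (Xn n @^-1` S0 r n)));
    last by apply/funext => n; rewrite -setC_post setCK.
  rewrite -[1](_ : (1 - 0)%:E = _); last by rewrite subr0.
  apply: probability_setC_cvg => [n n0|]; first by apply: mXn; exact: mS0.
  have W0 : (2 * z ^+ n)%:E @[n --> \oo] --> 0.
    apply: cvg_EFin; first exact: nearW.
    apply: (@cvg_geometric R 2 z).
    by case/andP: z01 => z0 z1; rewrite gtr0_norm.
  have merge0 : P (~` merge_event Xn g m r n) @[n --> \oo] --> 0.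
    rewrite -[0](_ : (1 - 1)%:E = _); last by rewrite subrr.
    by apply: probability_setC_cvg; [exact: mmerge|exact: merge].
  (* Union bound: the three terms vanish by the choice of S_n, by merging, and by the geometric
     bound on P (W n). *)
  have bound0 : P (Xn n @^-1` S n) + P (~` merge_event Xn g m r n)
      + (2 * z ^+ n)%:E @[n --> \oo] --> 0.
    have -> : (0 : \bar R) = 0 + 0 + 0 by rewrite !adde0.
    by apply: cvgeD => //; exact: cvgeD.
  apply: (squeeze_cvge _ (cvg_cst 0) bound0).
  exists 1%N => // n /= n0; rewrite measure_ge0/=.
  have mSn := mXn n _ (mS n n0); have mMn := measurableC (mmerge r n n0).
  have mSMn := measurableU _ _ mSn mMn.
  apply: (@le_trans _ _ (P (Xn n @^-1` S n `|` ~` merge_event Xn g m r n `|` W n))).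
    apply: le_measure (sub n); rewrite inE.
      by apply: mXn; exact: mS0.
    by apply: measurableU => //; exact: mW.
  apply: (le_trans (measureU2 _ mSMn (mW n n0))).
  by rewrite leeD ?PW//; exact: measureU2.

(* Part (2): almost sure statements *)
move=> merge; split.
  move=> [r r0 post0]; have [r1 [r2 [B [C [h1 h2 h3 h4 h5]]]]] := fwd r r0.
  (* Infinitely many rejections by [S0 r] is, after unfolding, the very event that [post0] makes
     null. *)
  exists r1, r2, B, C; split => //; exists (S0 r); split => //.
  exact: mS0.
move=> [r1 [r2 [B [C [h1 h2 h3 h4 [S [mS S0' h5]]]]]]].
have [r [z [W [r0 z01 mW PW sub]]]] := bwd _ _ _ _ _ h1 h2 h3 h4 mS h5.
exists r => //.
have merge0 : P (lim_sup_set (fun n => ~` merge_event Xn g m r n)) = 0.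
  rewrite -[lim_sup_set _]setCK -eventuallyE_lim_sup_set probability_setC.
    by rewrite merge// subee.
  rewrite eventuallyE_lim_sup_set; apply: measurableC.
  apply: measurable_lim_sup_set => n n0.
  by apply: measurableC; exact: mmerge.
have W0 : P (lim_sup_set W) = 0.
  by apply: lim_sup_set_geometric0 z01 mW PW.
have mlS : measurable (lim_sup_set (fun n => Xn n @^-1` S n)).
  by apply: measurable_lim_sup_set => n n0; apply: mXn; exact: mS.
have mlM : measurable (lim_sup_set (fun n => ~` merge_event Xn g m r n)).
  by apply: measurable_lim_sup_set => n n0; apply: measurableC; exact: mmerge.
have mlW := measurable_lim_sup_set mW.
have mlSM := measurableU _ _ mlS mlM.
(* The inclusion [sub] passes to limits superior, and the limit superior of the union on its right
   is this union of three null sets. *)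
have U0 : P (lim_sup_set (fun n => Xn n @^-1` S n)
    `|` lim_sup_set (fun n => ~` merge_event Xn g m r n) `|` lim_sup_set W) = 0.
  by rewrite !measureU0.
apply: subset_measure0 U0 => //.
- by apply: measurable_lim_sup_set => n n0; exact: mXn _ _ (mS0 r n n0).
- exact: measurableU.
- by rewrite -!lim_sup_setU; exact: sub_lim_sup_set.
Qed.
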